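(* Let $R=\mathrm{GR}(p^d,r)$ be the Galois ring of characteristic $p^d$ with residue field of order $p^r$, where $p>2$ is a prime, and let $K\le R^\times$. Then the cyclotomic scheme $\mathrm{Cyc}(K,R)$ is normal exactly in one of the following cases: (1) $d=1$ and either $(p,r)=(3,1)$ or $K\ne R^\times$; (2) $d>1$ and $K$ does not contain the group $1+p^{d-1}R$.
   Context: All rings have an identity. $\mathrm{GR}(p^d,r)$ denotes the (unique up to isomorphism) Galois ring of characteristic $p^d$ whose residue field has $p^r$ elements; it is a finite local commutative ring with maximal ideal $pR$. For a subgroup $K$ of $R^\times$, the cyclotomic scheme $\mathrm{Cyc}(K,R)$ is the pair $(R,\mathrm{Rel}(K,R))$, where $\mathrm{Rel}(K,R)$ is the set of binary relations $\{(x,y)\in R\times R:\ y-x\in sK\}$, $s\in R$. Its automorphism group $\mathrm{Aut}(\mathcal C)$ is the group of permutations $f$ of $R$ with $S^f=S$ for every $S\in\mathrm{Rel}(K,R)$. $\mathrm{A\Gamma L}_1(R)$ is the group of permutations $x\mapsto ax^\sigma+b$ with $a\in R^\times$, $b\in R$, $\sigma\in\mathrm{Aut}(R)$; the scheme is normal if $\mathrm{Aut}(\mathcal C)\le\mathrm{A\Gamma L}_1(R)$. *)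

(* Defs.v *)
From HB Require Import structures.
From mathcomp Require Import all_boot all_order all_fingroup all_algebra.
Set Implicit Arguments. Unset Strict Implicit. Unset Printing Implicit Defensive.
Import GRing.Theory.
Local Open Scope ring_scope.

Section Defs.
Variable R : finComUnitRingType.

Definition idealmul (a : R) : {set R} := [set x : R | [exists y : R, x == a * y]].

(* R is the Galois ring GR(p^d, r): a finite commutative local ring of
   characteristic p^d whose maximal ideal is pR and whose residue field
   R/pR has p^r elements. *)
Definition is_galois_ring (p d r : nat) : Prop :=
  [/\ [/\ prime p, (0 < d)%N & (0 < r)%N],
      (((p ^ d)%:R : R) = 0 /\ ((p ^ d.-1)%:R : R) != 0),
      (forall x : R, (x \is a GRing.unit) = (x \notin idealmul p%:R))
    & #|[set: R]| = (p ^ r * #|idealmul p%:R|)%N].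

Variable K : {group {unit R}}.

Definition sK (s : R) : {set R} := [set s * val k | k in K].

Definition cyc_rel (s : R) : {set R * R} := [set u : R * R | u.2 - u.1 \in sK s].

Definition cyc_aut : {set {perm R}} :=
  [set f : {perm R} | [forall s : R,
      [set (f u.1, f u.2) | u in cyc_rel s] == cyc_rel s]].

Definition in_AGammaL1 (f : R -> R) : Prop :=
  exists (a : {unit R}) (b : R) (sigma : {rmorphism R -> R}),
    bijective sigma /\ forall x, f x = val a * sigma x + b.

Definition cyc_normal : Prop := forall f : {perm R}, f \in cyc_aut -> in_AGammaL1 f.

Definition one_plus_contained (p d : nat) : Prop :=
  forall u : {unit R}, (exists x : R, val u = 1 + (p ^ d.-1)%:R * x) -> u \in K.
End Defs.

(* Main.v *)
Require Import Defs.
From HB Require Import structures.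
From mathcomp Require Import all_boot all_order all_fingroup all_algebra all_solvable all_field.
From mathcomp Require Import ring zify.
Set Implicit Arguments. Unset Strict Implicit. Unset Printing Implicit Defensive.
Import GRing.Theory.
Local Open Scope ring_scope.

(** An automorphism of the scheme is a permutation [f] with [f y - f x] in [(y - x) K]; after an
affine normalisation [f 0 = 0] and [f 1 = 1], and normality amounts to [f] being a ring morphism.

Over a field with [q] elements, [K] satisfies [z ^ k = 1] for some [0 < k < q - 1] such that
neither [k] nor [q - 1 - k] is divisible by [p]. Then [(f x - f y) ^ k = (x - y) ^ k], and power
sums show that only the monomials [x ^ (p ^ j)] occur in [f], so that [f] is additive. The map
[x |-> 1 / f (1 / x)] satisfies the same hypotheses, hence is additive too, and Hua's identity
makes [f] multiplicative.

For [d > 1], the residues [w] with [1 + p ^ (d - 1) w] in [K] form a proper additive subgroup of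
the residue field, killed by a nonzero additive functional [tau]; as
[(1 + p ^ i w) ^ (p ^ m) = 1 + p ^ (i + m) w'] with [w' = w] modulo [p], [tau w = 0] as soon as
[1 + p ^ i w] is in [K] for some [0 < i < d]. Perturbing the arguments of [f] by multiples of
[p ^ (d - 1)] shows that the maps [t |-> 1 / (f x - f (x - 1 / t))] are additive modulo [p], and
therefore that [f] is a morphism modulo [p]. Two automorphisms congruent modulo [p ^ i] differ by
[p ^ i e] with [tau ((e x - e y) / (f x - f y)) = 0], which forces [e] to be affine in [f]
modulo [p]; comparing [f] with [x |-> f (x + z) - f z] and [x |-> f (x z) / f z] lifts the
morphism property from [p ^ i] to [p ^ (i + 1)]. *)

(** * Power sums and polynomial maps on a finite field *)

Section FiniteField.
Variable F : finFieldType.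
Local Notation q := #|F|.

(** Translation by 1 permutes the field and adds [q] to the sum of its elements. *)
Lemma natr_card_finField : (q%:R : F) = 0.
Proof.
have -> : (q%:R : F) = \sum_(x : F) 1 by rewrite sumr_const.
apply: (addrI (\sum_(x : F) x)); rewrite addr0 -big_split /=.
by rewrite [RHS](reindex_inj (addIr (1 : F))).
Qed.

Lemma expf_card_pred (x : F) : x != 0 -> x ^+ q.-1 = 1.
Proof.
move=> x0; apply: (mulfI x0); rewrite -exprS prednK ?expf_card ?mulr1 //.
exact: ltnW (finNzRing_gt1 F).
Qed.

Lemma pnat_card_finField (p : nat) : p \in [pchar F] -> p.-nat q.
Proof.
move=> chp; have := abelem_pgroup (fin_ring_pchar_abelem chp).
by rewrite /pgroup cardsT.
Qed.

(** [X ^ i - 1] has at most [i] roots, fewer than there are nonzero elements. *)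
Lemma exists_expf_neq1 i : (0 < i < q.-1)%N -> exists2 w : F, w != 0 & w ^+ i != 1.
Proof.
move=> /andP[i0 iq].
have [/existsP[w /andP[]]|] := boolP [exists w : F, (w != 0) && (w ^+ i != 1)].
  by exists w.
rewrite negb_exists => /forallP h.
have := @max_unity_roots F i (enum [pred x : F | x != 0]) i0.
have -> : size (enum [pred x : F | x != 0]) = q.-1 by rewrite -cardE -(cardC1 0).
rewrite enum_uniq leqNgt iq => /(_ _ isT) E; suff: false by [].
apply: E; apply/allP => x; rewrite mem_enum inE => x0.
by have := h x; rewrite x0 /= negbK unity_rootE.
Qed.

(** Scaling the variable by some [w] with [w ^ i != 1] multiplies the sum by [w ^ i]; for [i = 0]
    the sum is [q] itself. *)
Lemma sum_expf i : (i < q.-1)%N -> \sum_(x : F) x ^+ i = 0.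
Proof.
case: i => [_|i iq].
  by under eq_bigr do rewrite expr0; rewrite sumr_const natr_card_finField.
have [//|w w0 w1] := @exists_expf_neq1 i.+1.
apply/eqP; set S := \sum_x _.
have E : S = w ^+ i.+1 * S.
  rewrite {1}/S (reindex_inj (mulfI w0)) mulr_sumr.
  by apply: eq_bigr => x _; rewrite exprMn.
have /eqP : (1 - w ^+ i.+1) * S = 0 by rewrite mulrBl mul1r -E subrr.
by rewrite mulf_eq0 subr_eq0 eq_sym (negPf w1).
Qed.

Lemma sum_expf_card_pred : \sum_(x : F) x ^+ q.-1 = -1.
Proof.
have q1 := finNzRing_gt1 F.
rewrite (bigD1 0) //= expr0n; have -> : (q.-1 == 0)%N = false by rewrite eqn0Ngt -subn1 subn_gt0 q1.
rewrite add0r (eq_bigr (fun=> 1)); last by move=> x; apply: expf_card_pred.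
rewrite sumr_const; have -> : #|[pred x : F | x != 0]| = q.-1 by rewrite -(cardC1 0).
by apply: (addIr 1); rewrite natr1 prednK ?natr_card_finField ?addNr // ltnW.
Qed.

Lemma sum_horner_eq0 (P : {poly F}) : (size P <= q.-1)%N -> \sum_(x : F) P.[x] = 0.
Proof.
move=> sP; under eq_bigr do rewrite horner_coef.
rewrite exchange_big big1 //= => i _; rewrite -mulr_sumr sum_expf ?mulr0 //.
exact: leq_trans (ltn_ord i) sP.
Qed.

End FiniteField.

(** * Hua's identity for additive maps compatible with inversion *)

Section Hua.
Variables (F : fieldType) (f g : F -> F).
Hypotheses (fD : {morph f : x y / x + y}) (gD : {morph g : x y / x + y}).
Hypotheses (f1 : f 1 = 1) (two_neq0 : 2%:R != 0 :> F).
Hypothesis fg : forall x, x != 0 -> f x * g x^-1 = 1.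

(** Applying [g] to [1 / x = 1 / (x (x + 1)) + 1 / (x + 1)], where [g (1 / y) = 1 / f y], yields
    [f (x (x + 1)) = f x (f x + 1)]. *)
Lemma hua_square x : f (x ^+ 2) = f x ^+ 2.
Proof.
have f0 : f 0 = 0 by apply: (addrI (f 0)); rewrite -fD !addr0.
have fN y : f (- y) = - f y by apply: (addrI (f y)); rewrite -fD !subrr.
have fn0 y : y != 0 -> f y != 0.
  by move=> /fg h; apply/eqP => E; move: h => /eqP; rewrite E mul0r eq_sym oner_eq0.
have gE y : y != 0 -> g y^-1 = (f y)^-1.
  by move=> y0; apply: (mulfI (fn0 _ y0)); rewrite fg // divff // fn0.
have [->|x0] := eqVneq x 0; first by rewrite f0 !expr0n.
have [x1|x1] := eqVneq (x + 1) 0.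
  by rewrite (eqP (_ : x == -1)) ?fN ?f1 ?sqrrN ?expr1n // -addr_eq0 x1.
have xx0 : x * (x + 1) != 0 by rewrite mulf_neq0.
have E : g x^-1 = g (x * (x + 1))^-1 + g (x + 1)^-1.
  by rewrite -gD; congr g; field; rewrite x0 x1.
move: E; rewrite !gE // => E.
have a0 := fn0 _ x0; have b0 := fn0 _ x1; have c0 := fn0 _ xx0.
have -> : x ^+ 2 = x * (x + 1) - x by ring.
rewrite fD fN; move: E b0; rewrite [f (x + 1)]fD f1 => E b0.
have : f (x * (x + 1)) = f x * (f x + 1).
  apply: invr_inj; rewrite -[LHS](addrK (f x + 1)^-1) -E.
  by field; rewrite a0 b0.
by move->; ring.
Qed.

(** Polarisation of [hua_square]. *)
Lemma hua_mul : {morph f : x y / x * y}.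
Proof.
move=> x y; apply: (mulfI two_neq0).
have := hua_square (x + y).
have -> : (x + y) ^+ 2 = x ^+ 2 + (x * y + x * y) + y ^+ 2 by ring.
rewrite !fD !hua_square => E.
have -> : 2%:R * f (x * y) = f x ^+ 2 + (f (x * y) + f (x * y)) + f y ^+ 2 - f x ^+ 2 - f y ^+ 2 by ring.
by rewrite E; ring.
Qed.

End Hua.

(** * Coefficients of polynomial maps as moments *)

Section Moments.
Variable F : finFieldType.
Local Notation q := #|F|.

(** Induction by Pascal's rule: the inner binomials of [q] vanish because
    [(1 + X) ^ q = 1 + X ^ q]. *)
Lemma bin_card_pred i : (i < q)%N -> 'C(q.-1, i)%:R = (-1) ^+ i :> F.
Proof.
have [p pr_p chp] := finPcharP F.
have q1 := finNzRing_gt1 F.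
have chq : [pchar {poly F}].-nat q.
  rewrite (eq_pnat _ (pchar_poly F)) (eq_pnat _ (pcharf_eq chp)).
  exact: pnat_card_finField.
have bin0_q j : (0 < j < q)%N -> 'C(q, j)%:R = 0 :> F.
  move=> /andP[j0 jq].
  have /(congr1 (fun P : {poly F} => P`_j)) := exprDn_pchar 1 'X chq.
  rewrite exprDn expr1n coefD coef1 coefXn coef_sum (bigD1 (inord j)) //= inordK 1?ltnW //.
  rewrite expr1n mul1r coefMn coefXn eqxx big1; last first.
    move=> k kj; rewrite expr1n mul1r coefMn coefXn; case: eqP => [E|]; last by rewrite mul0rn.
    by case/eqP: kj; apply: val_inj; rewrite /= inordK -?E // ltnS ltnW.
  by rewrite addr0 eqn0Ngt j0 /= (ltn_eqF jq) addr0 => ->.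
elim: i => [|i IHi] iq; first by rewrite bin0.
have := bin0_q i.+1; rewrite iq => /(_ isT).
rewrite -[in 'C(q, _)](prednK (ltnW q1)) binS natrD IHi ?(ltnW iq) // => /eqP.
by rewrite addr_eq0 => /eqP->; rewrite exprS mulN1r.
Qed.

(** As a function of [y], [(x - y) ^+ q.-1] is the indicator of [y != x]. *)
Lemma interpolation (f : F -> F) x :
  f x = \sum_y f y - \sum_y f y * (x - y) ^+ q.-1.
Proof.
have q1 := finNzRing_gt1 F.
rewrite (bigD1 x) //= [in X in _ - X](bigD1 x) //= subrr expr0n.
have -> : (q.-1 == 0)%N = false by rewrite eqn0Ngt -subn1 subn_gt0 q1.
rewrite mulr0 add0r -addrA -sumrB big1 ?addr0 // => y yx.
by rewrite expf_card_pred ?mulr1 ?subrr // subr_eq0 eq_sym.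
Qed.

(** For [0 < i < q], [moment f (q.-1 - i)] is up to sign the coefficient of [x ^ i] in the
    polynomial of degree below [q] representing [f]. *)
Definition moment (f : F -> F) n : F := \sum_x f x * x ^+ n.

Lemma additive_of_moments (p : nat) (f : F -> F) :
  p \in [pchar F] -> (2 < q)%N -> f 0 = 0 ->
  (forall i, (0 < i < q)%N -> (forall j, i <> p ^ j)%N -> moment f (q.-1 - i) = 0) ->
  {morph f : x y / x + y}.
Proof.
move=> chp q2 f0 fM.
have pr_p := pcharf_prime chp.
have q1 : (1 < q)%N by apply: ltnW.
have qp : (p %| q)%N by rewrite (dvdn_pcharf chp) natr_card_finField.
(* This is the case [i = q - 1], which is not a power of [p] because [p] divides [q] and [q > 2]. *)
have S0 : \sum_y f y = 0.
  have <- : moment f (q.-1 - q.-1) = \sum_y f y.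
    by apply: eq_bigr => y _; rewrite subnn expr0 mulr1.
  apply: fM; first by rewrite ltn_predL (ltnW q1) -subn1 subn_gt0 q1.
  case=> [|j] E; first by move: q2; rewrite -[q]prednK ?(ltnW q1) // E.
  have : (p %| q - q.-1)%N by rewrite dvdn_sub // E expnS dvdn_mulr.
  by rewrite -{1}[q]prednK ?(ltnW q1) // subSnn dvdn1 => /eqP E1; rewrite E1 in pr_p.
pose c i := 'C(q.-1, i)%:R * (-1) ^+ (q.-1 - i) * moment f (q.-1 - i).
have fE x : f x = - \sum_(i < q.-1.+1) c i * x ^+ i.
  rewrite {1}[f x]interpolation S0 sub0r; congr (- _).
  transitivity (\sum_y \sum_(i < q.-1.+1)
     'C(q.-1, i)%:R * (-1) ^+ (q.-1 - i) * (f y * y ^+ (q.-1 - i)) * x ^+ i).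
    apply: eq_bigr => y _; rewrite addrC exprDn mulr_sumr; apply: eq_bigr => i _.
    rewrite (exprNn y) -mulr_natl.
    move: ('C(_, _)%:R) ((-1) ^+ _) (y ^+ _) (x ^+ _) => a b u v; ring.
  rewrite exchange_big; apply: eq_bigr => i _ /=.
  by rewrite -mulr_suml -mulr_sumr.
have cD i x y : (i < q)%N -> c i * (x + y) ^+ i = c i * x ^+ i + c i * y ^+ i.
  move=> iq; rewrite -mulrDr.
  have [M0|M0] := eqVneq (moment f (q.-1 - i)) 0; first by rewrite /c M0 mulr0 !mul0r.
  (* For [i = 0] the moment is again the sum of [f], since [f 0 = 0]. *)
  have [i0|i0] := posnP i.
    case/eqP: M0; rewrite i0 subn0 -[RHS]S0; apply: eq_bigr => y' _.
    by have [->|y0] := eqVneq y' 0; rewrite ?f0 ?mul0r // expf_card_pred ?mulr1.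
  congr (_ * _).
  suff [j ->] : exists j, i = (p ^ j)%N.
    by apply: exprDn_pchar; rewrite (eq_pnat _ (pcharf_eq chp)) pnatX pnat_id.
  have [/'exists_eqP[j ->]|] := boolP [exists j : 'I_i, i == (p ^ j)%N]; first by exists j.
  rewrite negb_exists => /forallP h; case/eqP: M0; apply: fM; rewrite ?i0 // => j E.
  have ji : (j < i)%N by rewrite E ltn_expl ?prime_gt1.
  by have := h (Ordinal ji); rewrite /= -E eqxx.
move=> x y; rewrite !fE -opprD -big_split /=; congr (- _).
by apply: eq_bigr => -[i] /=; rewrite prednK ?(ltnW q1) // => iq _; rewrite cD.
Qed.

End Moments.

(** * Additivity of maps preserving a power of differences *)

Section AdditiveFromPowers.
Variable F : finFieldType.
Variable N : nat.
Hypothesis cardF : #|F| = N.+1.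

Let expN (x : F) : x != 0 -> x ^+ N = 1.
Proof. by move=> /expf_card_pred; rewrite cardF. Qed.

Let sum_exp i : (i < N)%N -> \sum_(x : F) x ^+ i = 0.
Proof. by move=> iN; apply: sum_expf; rewrite cardF. Qed.

Let sum_expN : \sum_(x : F) x ^+ N = -1.
Proof. by rewrite -sum_expf_card_pred cardF. Qed.

Let binN i : (i <= N)%N -> 'C(N, i)%:R = (-1) ^+ i :> F.
Proof. by move=> iN; rewrite -bin_card_pred cardF. Qed.

(** For positive exponents [y ^ e] depends only on [e] modulo [N], and [N] is the only multiple of
    [N] strictly between 0 and [2 N]. *)
Lemma sum_expf_shift n m : (0 < m)%N -> (n + m < N + N)%N ->
  \sum_(y : F) y ^+ (n + m) = - (n + m == N)%N%:R.
Proof.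
move=> m0 nm; have [E|E|E] := ltngtP (n + m)%N N.
- by rewrite sum_exp ?oppr0.
- pose e := (n + m - N)%N.
  transitivity (\sum_(y : F) y ^+ e); last by rewrite oppr0 sum_exp // /e; lia.
  apply: eq_bigr => y _.
  have [->|y0] := eqVneq y 0; last by rewrite -(subnKC (ltnW E)) exprD expN ?mul1r.
  by rewrite !expr0n; congr (_%:R); rewrite /e; lia.
- by rewrite E sum_expN.
Qed.

(** In the expansion of [(x - y) ^ k], only the term in [y ^ c] brings the exponent of [y] to [N];
    the other terms sum to zero. *)
Lemma sum_translates_pow k c x : (0 < c <= k)%N -> (k < N)%N ->
  \sum_(y : F) y ^+ (N - c) * (x - y) ^+ k
    = - ((-1) ^+ c * 'C(k, c)%:R) * x ^+ (k - c).
Proof.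
move=> /andP[c0 ck] kq.
transitivity (\sum_(m < k.+1) (-1) ^+ m * 'C(k, m)%:R * x ^+ (k - m) *
    \sum_(y : F) y ^+ (N - c + m)).
  under eq_bigr => y _ do rewrite exprDn mulr_sumr.
  rewrite exchange_big; apply: eq_bigr => m _ /=; rewrite mulr_sumr.
  apply: eq_bigr => y _; rewrite (exprNn y) -mulr_natl exprD.
  by move: ('C(k, m)%:R) ((-1) ^+ m) (x ^+ _) (y ^+ _) (y ^+ m) => a b u v w; ring.
rewrite (bigD1 (inord c)) //= inordK ?ltnS // subnK; last by lia.
rewrite sum_expN mulrN1 mulNr big1 ?addr0 // => m mc.
have mk := ltn_ord m.
have mc' : nat_of_ord m != c.
  by apply: contraNneq mc => E; apply/eqP/val_inj; rewrite /= inordK // E.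
have [m0|m0] := posnP m.
  by rewrite m0 addn0 sum_exp ?mulr0 //; lia.
rewrite sum_expf_shift //; last by lia.
have -> : (N - c + m == N)%N = false by apply/negbTE; lia.
by rewrite oppr0 mulr0.
Qed.

(** The coefficient of degree [l] is the sum of the [a y]. *)
Lemma size_sum_translates l (a b : F -> F) : \sum_y a y = 0 ->
  (size (\sum_y a y *: ('X - (b y)%:P) ^+ l)%R <= l)%N.
Proof.
move=> a0; apply/leq_sizeP => j lj; rewrite coef_sum.
have [E|lj'] := eqVneq j l; last first.
  apply: big1 => y _; rewrite coefZ nth_default ?mulr0 //.
  by rewrite size_exp_XsubC ltn_neqAle eq_sym lj'.
rewrite -[RHS]a0; apply: eq_bigr => y _; rewrite coefZ E.
have /monicP := monic_exp l (monicXsubC (b y)).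
by rewrite /lead_coef size_exp_XsubC => ->; rewrite mulr1.
Qed.

(** Reduces exponents below [N], as the degree bounds require: [l] is [k p ^ j] modulo [N], nonzero
    because [p] is prime to [N], and the two exponents on the left add up to [N p ^ j]. *)
Lemma exists_frobenius_exponent (p j k : nat) : p \in [pchar F] -> (0 < k < N)%N ->
  exists2 l, (0 < l < N)%N &
    forall z : F, z ^+ (k * p ^ j) = z ^+ l /\ z ^+ ((N - k) * p ^ j) = z ^+ (N - l).
Proof.
move=> chp /andP[k0 kq].
have p0 : (0 < p ^ j)%N by rewrite expn_gt0 prime_gt0 ?(pcharf_prime chp).
have pN : ~~ (p %| N)%N.
  rewrite (dvdn_pcharf chp) -[N%:R](addrK 1) natr1 -cardF natr_card_finField.
  by rewrite sub0r oppr_eq0 oner_eq0.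
pose l := ((k * p ^ j) %% N)%N.
have q1 : (0 < N)%N by lia.
have lq : (l < N)%N by rewrite ltn_mod.
have l0 : (0 < l)%N.
  rewrite lt0n; apply: contraL kq => /eqP /eqP; rewrite -/(dvdn _ _) Gauss_dvdl.
    by move=> /dvdn_leq; rewrite -leqNgt; apply.
  by rewrite coprime_sym coprimeXl // prime_coprime ?(pcharf_prime chp).
exists l; first by rewrite l0.
move=> z; have [->|z0] := eqVneq z 0.
  by rewrite !expr0n; split; congr (_%:R); lia.
have zl : z ^+ (k * p ^ j) = z ^+ l.
  rewrite {1}(divn_eq (k * p ^ j) N) exprD mulnC exprM.
  by rewrite expN // expr1n mul1r.
split=> //; apply: (mulIf (expf_neq0 l z0)).
rewrite -{1}zl -!exprD -mulnDl !subnK ?(ltnW kq) ?(ltnW lq) //.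
by rewrite exprM expN // expr1n.
Qed.

(* By Vandermonde, ['C(N, i) = (-1) ^ i] is the sum of the products ['C(k, c) * 'C(N - k, d)]
   over [c + d = i]; if those with [0 < c] and [0 < d] vanished, so would the two others. *)
Lemma exists_bin_split (p k i : nat) : p \in [pchar F] -> (1 < i <= N)%N -> ~~ (p %| i)%N ->
  (k <= N)%N -> ~~ (p %| k)%N -> ~~ (p %| N - k)%N ->
  exists c d, [/\ (0 < c)%N, (0 < d)%N, (c + d = i)%N,
    'C(k, c)%:R != 0 :> F & 'C(N - k, d)%:R != 0 :> F].
Proof.
move=> chp /andP[i1 iq] pi kq pk pk'.
set k' := (N - k)%N in pk' *.
have [/existsP[c /and4P[h1 h2 h3 h4]]|] := boolP [exists c : 'I_i.+1,
   [&& (0 < c)%N, (0 < i - c)%N, 'C(k, c)%:R != 0 :> F & 'C(k', i - c)%:R != 0 :> F]].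
  by exists c, (i - c)%N; split=> //; rewrite subnKC // -ltnS.
rewrite negb_exists => /forallP h.
have {}h c : (0 < c < i)%N -> 'C(k, c)%:R * 'C(k', i - c)%:R = 0 :> F.
  move=> /andP[c0 ci]; apply/eqP; rewrite mulf_eq0 -[_ || _]negbK negb_or.
  have := h (inord c); rewrite inordK; last by rewrite ltnS ltnW.
  by rewrite c0 subn_gt0 ci.
(* As [i * 'C(m, i)] is a multiple of ['C(m, i.-1)] and [p] does not divide [i], vanishing passes
   from ['C(m, i.-1)] to ['C(m, i)]. *)
have top n m : ~~ (p %| n)%N -> 'C(n, 1)%:R * 'C(m, i.-1)%:R = 0 :> F -> 'C(m, i)%:R = 0 :> F.
  move=> pn /eqP; rewrite bin1 mulf_eq0 -(dvdn_pcharf chp) (negPf pn) /= => /eqP E.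
  apply/eqP; have /eqP : i%:R * 'C(m, i)%:R = 0 :> F.
    by rewrite -natrM -{1 2}[i]prednK ?(ltnW i1) // mul_bin_left natrM E mulr0.
  by rewrite mulf_eq0 -(dvdn_pcharf chp) (negPf pi).
have Ck' : 'C(k', i)%:R = 0 :> F.
  by apply: (top k) => //; rewrite -subn1 h // i1.
have Ck : 'C(k, i)%:R = 0 :> F.
  apply: (top k') => //; rewrite mulrC.
  have := h i.-1; rewrite -subn1 subKn ?(ltnW i1) //; apply.
  by rewrite subn_gt0 i1 ltn_subrL (ltnW i1).
have : 'C(N, i)%:R = 0 :> F.
  have -> : N = (k + k')%N by rewrite subnKC.
  rewrite -binomial.Vandermonde natr_sum big1 // => c _; rewrite natrM.
  have ci := ltn_ord c.
  have [->|c0] := posnP c; first by rewrite bin0 mul1r subn0.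
  have [E|ci'] := eqVneq (nat_of_ord c) i; first by rewrite E Ck mul0r.
  by apply: h; rewrite c0 ltn_neqAle ci' -ltnS.
by move=> /eqP; rewrite binN // signr_eq0.
Qed.

(* The coefficient of [x ^ (i' p ^ j)] in [f] is, up to sign, the sum of the [f x * X ^ (N - i')]
   with [X = x ^ (p ^ j)]. Splitting [i' = c + d], both [X ^ (k - c)] and [X ^ (N - k - d)] are
   combinations of powers of differences, hence polynomials in [f x] of degree less than [l] and
   [N - l]: the sum runs over the values of a polynomial of degree less than [N]. *)
Lemma additive_of_powers (p k : nat) (f : F -> F) :
  p \in [pchar F] -> (1 < N)%N -> injective f -> f 0 = 0 ->
  (0 < k < N)%N -> ~~ (p %| k)%N -> ~~ (p %| N - k)%N ->
  (forall x y, (f x - f y) ^+ k = (x - y) ^+ k) ->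
  {morph f : x y / x + y}.
Proof.
move=> chp q2 finj f0 /andP[k0 kq] pk pk' fk.
have fk' x y : (f x - f y) ^+ (N - k) = (x - y) ^+ (N - k).
  have [->|xy] := eqVneq x y; first by rewrite !subrr.
  have xy0 : x - y != 0 by rewrite subr_eq0.
  have fxy0 : f x - f y != 0 by rewrite subr_eq0 (inj_eq finj).
  apply: (mulIf (expf_neq0 k xy0)).
  by rewrite -{1}fk -!exprD subnK ?expN // ltnW.
apply: (additive_of_moments chp) => // [|i]; rewrite cardF // => /andP[i0 iq] ip /=.
rewrite /moment.
have pr_p := pcharf_prime chp.
have [i' pi' iE] := pfactor_coprime pr_p i0.
set j := logn p i in iE.
rewrite prime_coprime // in pi'.
have i'1 : (1 < i' <= N)%N.
  case: i' => [|[|i']] in pi' iE *; first by rewrite dvdn0 in pi'.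
    by case: (ip j); rewrite -[RHS]mul1n.
  by rewrite ltnS; apply: leq_trans (_ : i'.+2 <= i)%N _ => //; rewrite iE leq_pmulr // expn_gt0 prime_gt0.
have [c [d [c0 d0 cd kc kd]]] := exists_bin_split chp i'1 pi' (ltnW kq) pk pk'.
have [||l /andP[l0 lq] lE] := @exists_frobenius_exponent p j k; rewrite ?k0 //.
pose X (x : F) := x ^+ (p ^ j).
have XB x y : X (x - y) = X x - X y.
  apply: (addIr (X y)); rewrite subrK /X -exprDn_pchar ?subrK //.
  by rewrite (eq_pnat _ (pcharf_eq chp)) pnatX pnat_id.
have Xinj : injective X.
  move=> x y /eqP; rewrite -subr_eq0 -XB expf_eq0 subr_eq0 => /andP[_] /eqP //.
have c_le : (c <= k)%N by rewrite leqNgt; apply: contra kc => /bin_small ->.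
have d_le : (d <= N - k)%N by rewrite leqNgt; apply: contra kd => /bin_small ->.
have cN : (c < N)%N := leq_ltn_trans c_le kq.
have dN : (d < N)%N by apply: leq_ltn_trans d_le _; rewrite ltn_subrL k0 (leq_ltn_trans _ kq).
have cdN : (k - c + (N - k - d) + i' = N)%N by clear -c_le d_le cd kq; lia.
(* At [f x] this polynomial takes, up to a constant, the value of a power of [X x]; its size is at
   most [n] because its coefficients sum to zero. *)
pose P e n := \sum_y X y ^+ (N - e) *: ('X - (f y)%:P) ^+ n.
have PE e n k1 x : (0 < e <= k1)%N -> (k1 < N)%N ->
    (forall x y, (f x - f y) ^+ n = X (x - y) ^+ k1) ->
    (P e n).[f x] = - ((-1) ^+ e * 'C(k1, e)%:R) * X x ^+ (k1 - e).
  move=> ek kq1 nE; rewrite -sum_translates_pow // [RHS](reindex_inj Xinj) /P horner_sum.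
  by apply: eq_bigr => y _; rewrite hornerZ horner_exp hornerXsubC nE XB.
have PS e n : (0 < e < N)%N -> (size (P e n) <= n)%N.
  move=> e0; apply: size_sum_translates.
  transitivity (\sum_(y : F) y ^+ (N - e)); first by rewrite [RHS](reindex_inj Xinj).
  by apply: sum_exp; case/andP: e0 => e0 eN; rewrite ltn_subrL e0 (leq_trans _ eN).
have E1 x y : (f x - f y) ^+ l = X (x - y) ^+ k.
  by have [<- _] := lE (f x - f y); rewrite exprM fk -exprM mulnC exprM.
have E2 x y : (f x - f y) ^+ (N - l) = X (x - y) ^+ (N - k).
  by have [_ <-] := lE (f x - f y); rewrite exprM fk' -exprM mulnC exprM.
pose A := ((-1) ^+ c * 'C(k, c)%:R) * ((-1) ^+ d * 'C(N - k, d)%:R) : F.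
have A0 : A != 0 by rewrite !mulf_neq0 ?signr_eq0.
apply: (mulfI A0); rewrite mulr0.
(* The two factors have sizes at most [l] and [N - l], so their product has size at most [N - 1],
   and ['X], which contributes [f x], raises this to [N]. *)
have H := @sum_horner_eq0 F ('X * (P c l * P d (N - l)%N)).
rewrite -[RHS]H; last first.
  rewrite cardF; apply: leq_trans (size_polyMleq _ _) _; rewrite size_polyX add2n /=.
  have s1 : (size (P c l) <= l)%N by apply: PS; rewrite c0.
  have s2 : (size (P d (N - l)%N) <= N - l)%N by apply: PS; rewrite d0.
  apply: leq_ltn_trans (size_polyMleq _ _) _.
  have := leq_add s1 s2; rewrite subnKC ?(ltnW lq) //.
  by case: (_ + _)%N => //= _; apply: leq_ltn_trans kq.
rewrite [RHS](reindex_inj finj) mulr_sumr; apply: eq_bigr => x _.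
rewrite !hornerM hornerX (PE c l k) ?(PE d (N - l)%N (N - k)%N) ?c0 ?d0 //; last first.
  by rewrite ltn_subrL k0 (leq_ltn_trans _ kq).
have [->|x0] := eqVneq x 0; first by rewrite f0 !(mul0r, mulr0).
have -> : x ^+ (N - i) = X x ^+ (k - c) * X x ^+ (N - k - d).
  apply: (mulIf (expf_neq0 i x0)); rewrite -!exprD subnK ?(ltnSE iq) //.
  rewrite {1}iE mulnC exprM -/(X x) -exprD expN //.
  by rewrite cdN expN ?expf_neq0.
by rewrite /A; move: ((-1) ^+ c) ((-1) ^+ d) => s t; ring.
Qed.

End AdditiveFromPowers.

(** * Maps of a finite field preserving a power of differences *)

Section McConnel.
Variables (F : finFieldType) (N : nat).
Hypothesis cardF : #|F| = N.+1.

Lemma hom_of_powers (p k : nat) (f : F -> F) :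
  p \in [pchar F] -> (2 < p)%N -> injective f -> f 0 = 0 -> f 1 = 1 ->
  (0 < k < N)%N -> ~~ (p %| k)%N -> ~~ (p %| N - k)%N ->
  (forall x y, (f x - f y) ^+ k = (x - y) ^+ k) ->
  {morph f : x y / x + y} /\ {morph f : x y / x * y}.
Proof.
move=> chp p2 finj f0 f1 kN pk pk' fk.
have k0 : (0 < k)%N by case/andP: kN.
have N1 : (1 < N)%N by case/andP: kN => k0' /(leq_ltn_trans k0').
have two0 : 2%:R != 0 :> F by rewrite -(dvdn_pcharf chp) gtnNdvd.
have fD := additive_of_powers cardF chp N1 finj f0 kN pk pk' fk.
have fX x : f x ^+ k = x ^+ k by rewrite -[f x]subr0 -f0 fk subr0.
have fn0 x : x != 0 -> f x != 0 by rewrite -{2}f0 (inj_eq finj).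
pose g x := (f x^-1)^-1.
have ginj : injective g by move=> x y /invr_inj/finj/invr_inj.
have g0 : g 0 = 0 by rewrite /g invr0 f0 invr0.
have gX x : g x ^+ k = x ^+ k by rewrite /g exprVn fX exprVn invrK.
have gk x y : (g x - g y) ^+ k = (x - y) ^+ k.
  have [->|x0] := eqVneq x 0; first by rewrite g0 !sub0r (exprNn (g y)) (exprNn y) gX.
  have [->|y0] := eqVneq y 0; first by rewrite g0 !subr0 gX.
  have x0' := fn0 _ (invr_neq0 x0); have y0' := fn0 _ (invr_neq0 y0).
  (* Numerator and denominator are built from a difference and from values of [f], whose [k]-th
     powers are known. *)
  have -> : g x - g y = (f y^-1 - f x^-1) / (f x^-1 * f y^-1).
    by rewrite /g; field; rewrite x0' y0'.
  rewrite expr_div_n fk exprMn !fX -exprMn -expr_div_n; congr (_ ^+ k).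
  by field; rewrite x0 y0 oner_eq0.
have gD := additive_of_powers cardF chp N1 ginj g0 kN pk pk' gk.
split=> //; apply: (hua_mul fD gD f1 two0) => x x0.
by rewrite /g invrK divff // fn0.
Qed.

End McConnel.

(** Used with [m] the order of [K]. If [k = m] fails, then [m] is -1 modulo [p], as is [N]; then
    [k = 2 m] works, [k] being -2 and [N - k] being 1 modulo [p]. Since [N] is not -2 modulo [p],
    [2 m] differs from [N]. *)
Lemma exists_exponent_coprime (p N m : nat) : (2 < p)%N -> (p %| N.+1)%N ->
  (m %| N)%N -> (0 < m < N)%N ->
  exists k, [/\ (m %| k)%N, (0 < k < N)%N, ~~ (p %| k)%N & ~~ (p %| N - k)%N].
Proof.
move=> p2 pN mN /andP[m0 mltN].
have pN' : ~~ (p %| N)%N.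
  apply/negP => h; have := dvdn_sub pN h; rewrite subSnn dvdn1 => /eqP E.
  by rewrite E in p2.
have pm : ~~ (p %| m)%N by apply: contra pN' => /dvdn_trans; apply.
have [h|h] := boolP (p %| N - m)%N; last by exists m; rewrite m0 mltN.
have p_m1 : (p %| m.+1)%N.
  by have := dvdn_sub pN h; rewrite subSn ?leq_subr // subKn //; apply: ltnW.
have p3 : ~~ (p %| 1)%N by rewrite dvdn1; case: p p2 {pN pN' pm h p_m1} => [|[]].
have mm : (m.*2 < N)%N.
  have [c NE] := dvdnP mN.
  have c1 : (1 < c)%N by rewrite NE -{1}[m]mul1n ltn_pmul2r in mltN.
  rewrite -muln2 mulnC NE ltn_pmul2r // ltn_neqAle c1 andbT.
  apply: contraNneq p3 => c2; have : (p %| m.+1.*2)%N by rewrite -muln2 dvdn_mulr.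
  rewrite doubleS -muln2 mulnC c2 -NE => /dvdn_sub/(_ pN).
  by rewrite subSnn.
exists m.*2; split.
- by rewrite -muln2 dvdn_mulr.
- by rewrite double_gt0 m0 mm.
- apply: contra p3 => h2.
  have : (p %| m.+1.*2 - m.*2)%N by rewrite dvdn_sub // -muln2 dvdn_mulr.
  rewrite doubleS -addn2 addKn => p_2.
  by move: (dvdn_leq (isT : 0 < 2)%N p_2); rewrite leqNgt p2.
apply/negP => h2; case/negP: pm.
by have := dvdn_sub h h2; rewrite -addnn subnDA subKn // leq_subRL ?addnn // ltnW.
Qed.

(** * Maps of a finite field with slopes in a proper additive subgroup *)

Section SlopesInKernel.
Variable F : finFieldType.
Local Notation q := #|F|.

Lemma additive0 (U V : zmodType) (G : U -> V) : {morph G : x y / x + y} -> G 0 = 0.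
Proof. by move=> GD; apply: (addrI (G 0)); rewrite -GD !addr0. Qed.

Lemma additiveB (U V : zmodType) (G : U -> V) :
  {morph G : x y / x + y} -> {morph G : x y / x - y}.
Proof. by move=> GD x y; apply: (addIr (G y)); rewrite -GD !subrK. Qed.

(* The zero set of a nonzero additive map has at most [q / 2] elements, and so has a proper
   subgroup of the multiplicative group; both cannot cover the field. *)
Lemma additive_eq0 (G : F -> F) i : {morph G : x y / x + y} -> (0 < i < q.-1)%N ->
  (forall u, u != 0 -> u ^+ i != 1 -> G (u - 1)^-1 = 0) -> forall v, G v = 0.
Proof.
move=> GD iN Gu v; apply/eqP/contraT => Gv.
have q1 := finNzRing_gt1 F.
pose Z := [set x | G x == 0].
pose H := [set u : F | (u != 0) && (u ^+ i == 1)].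
have cZ : (#|Z| + #|Z| <= q)%N.
  rewrite -{2}(card_imset _ (addrI v)) -[q]cardsT.
  rewrite -(cardsUI Z) (_ : Z :&: _ = set0) ?cards0 ?addn0 ?subset_leq_card ?subsetT //.
  apply/setP => x; rewrite !inE; apply/negP => /andP[/eqP Gx /imsetP[y]].
  rewrite inE => /eqP Gy xE; case/eqP: Gv.
  by rewrite -Gx xE GD Gy addr0.
have cH : (#|H| + #|H| <= q.-1)%N.
  have [w w0 wi] := exists_expf_neq1 iN.
  rewrite -{2}(card_imset _ (mulfI w0)) -(cardC1 (0 : F)) -(cardsE (predC1 0)).
  rewrite -(cardsUI H) (_ : H :&: _ = set0) ?cards0 ?addn0 ?subset_leq_card //.
    apply/subsetP => x; rewrite !inE => /orP[/andP[]//|/imsetP[y]].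
    by rewrite inE => /andP[y0 _] ->; rewrite mulf_neq0.
  apply/setP => x; rewrite !inE; apply/negP => /andP[/andP[x0 /eqP xi] /imsetP[y]].
  rewrite inE => /andP[_ /eqP yi] xE; case/eqP: wi.
  by rewrite -xi xE exprMn yi mulr1.
(* [v |-> 1 + v^-1] sends the points where [G] is nonzero injectively into [H] with 1 replaced by
   0. *)
have cZH : (#|~: Z| <= #|H|)%N.
  have H1 : 1 \in H by rewrite inE oner_eq0 expr1n eqxx.
  have -> : #|H| = #|(0 |: H) :\ 1|.
    apply/eqP; rewrite -(eqn_add2l 1); have := cardsD1 1 (0 |: H).
    by rewrite in_setU1 H1 orbT /= => <-; rewrite cardsU1 inE eqxx.
  have inj1 : injective (fun v : F => 1 + v^-1) by move=> x y /addrI/invr_inj.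
  rewrite -(card_imset _ inj1); apply/subset_leq_card/subsetP => u /imsetP[x].
  rewrite !inE => Gx ->; set u1 := 1 + x^-1.
  have x0 : x != 0 by apply: contraNneq Gx => ->; rewrite (additive0 GD).
  have xE : (u1 - 1)^-1 = x by rewrite addrC addKr invrK.
  rewrite -subr_eq0 -invr_eq0 xE x0 /=.
  have [//|u0] := eqVneq u1 0; apply: contraNT Gx => ui.
  by rewrite -xE Gu.
move: cZH cZ cH (cardsC Z) q1; move: #|Z| #|~: Z| #|H| #|F| => a b c n; clear; lia.
Qed.

(** Fourier inversion on the multiplicative group: in the double sum of [(s / t) ^ i * f s], only
    [i = 0] survives by hypothesis, and only [s = t] by the geometric series, with weight
    [q - 1 = -1]. *)
Lemma constant_of_moments (f : F -> F) :
  (forall i, (0 < i < q.-1)%N -> \sum_(s | s != 0) s ^+ i * f s = 0) ->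
  forall t, t != 0 -> f t = f 1.
Proof.
move=> fM; have q1 := finNzRing_gt1 F.
have N1 : q.-1%:R = -1 :> F.
  by apply: (addIr 1); rewrite natr1 prednK ?natr_card_finField ?addNr // ltnW.
suff H t : t != 0 -> \sum_(s | s != 0) f s = - f t.
  by move=> t t0; apply: oppr_inj; rewrite -!H ?oner_neq0.
move=> t0.
transitivity (\sum_(s | s != 0) \sum_(i < q.-1) (s / t) ^+ i * f s).
  rewrite exchange_big /=; move: fM; case: q.-1 => [|N] in N1 * => fM.
    by move: N1 => /eqP; rewrite eq_sym oppr_eq0 oner_eq0.
  rewrite big_ord_recl [X in _ + X]big1 ?addr0 => [|i _].
    by apply: eq_bigr => s _; rewrite expr0 mul1r.
  transitivity (t ^- i.+1 * \sum_(s | s != 0) s ^+ i.+1 * f s); last by rewrite fM ?mulr0 //= ltnS.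
  by rewrite mulr_sumr; apply: eq_bigr => s _; rewrite expr_div_n mulrAC mulrC.
rewrite (bigD1 t) //= divff // [X in _ + X]big1 ?addr0 => [|s /andP[s0 st]].
  by rewrite -mulr_suml; under eq_bigr do rewrite expr1n; rewrite sumr_const card_ord N1 mulN1r.
rewrite -mulr_suml; apply/eqP; rewrite mulf_eq0; apply/orP; left.
have st1 : s / t - 1 != 0.
  by rewrite subr_eq0; apply: contra st => /eqP E; rewrite -[s](divfK t0) E mul1r.
apply/eqP/(mulfI st1); rewrite mulr0 -subrX1 expf_card_pred ?subrr //.
by rewrite mulf_neq0 ?invr_eq0.
Qed.

Variables (tau : F -> F) (x0 : F).
Hypotheses (tauD : {morph tau : x y / x + y}) (tau_x0 : tau x0 != 0).

Lemma tau_nondegenerate x : (forall t, t != 0 -> tau (t * x) = 0) -> x = 0.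
Proof.
move=> h; apply/eqP/contraT => nx0; case/eqP: tau_x0; rewrite -[x0](divfK nx0).
apply: h; rewrite mulf_neq0 ?invr_eq0 //.
by apply: contraNneq tau_x0 => ->; rewrite (additive0 tauD).
Qed.

(** With [b s = s (e (1 / s) - e 0)], the slope between [1 / s] and [1 / (u s)] is
    [b s + (b s - b (u s)) / (u - 1)]. So each moment [G v] of [s |-> tau (v * b s)] is multiplied
    by [u ^ i] at [v = 1 / (u - 1)], hence vanishes there if [u ^ i != 1], and then everywhere by
    [additive_eq0]. Therefore [b] is constant. *)
Lemma affine_of_slopes (e : F -> F) :
  (forall x y, x != y -> tau ((e x - e y) / (x - y)) = 0) ->
  forall x, e x - e 0 = (e 1 - e 0) * x.
Proof.
move=> eS.
pose b s := s * (e s^-1 - e 0).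
have tb s : s != 0 -> tau (b s) = 0.
  move=> s0; have := eS s^-1 0; rewrite invr_eq0 subr0 invrK mulrC => -> //.
have tbu s u : s != 0 -> u != 0 -> u != 1 -> tau ((u - 1)^-1 * b s) = tau ((u - 1)^-1 * b (u * s)).
  move=> s0 u0 u1; have u1' : u - 1 != 0 by rewrite subr_eq0.
  have us0 : u * s != 0 by rewrite mulf_neq0.
  apply/eqP; rewrite -subr_eq0 -(additiveB tauD); apply/eqP.
  have su : s != u * s by rewrite -{1}[s]mul1r (inj_eq (mulIf s0)) eq_sym.
  have := eS s^-1 (u * s)^-1; rewrite (inj_eq invr_inj) => /(_ su).
  have -> : (e s^-1 - e (u * s)^-1) / (s^-1 - (u * s)^-1)
      = b s + ((u - 1)^-1 * b s - (u - 1)^-1 * b (u * s)).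
    rewrite /b; field.
    by rewrite u1' s0 u0.
  by rewrite tauD tb // add0r.
have bc s : s != 0 -> b s = b 1.
  move=> s0; apply/eqP; rewrite -subr_eq0; apply/eqP/tau_nondegenerate => v _.
  apply/eqP; rewrite mulrBr (additiveB tauD) subr_eq0; apply/eqP.
  apply: (@constant_of_moments (fun s => tau (v * b s))) => // i iN.
  pose G v := \sum_(s | s != 0) s ^+ i * tau (v * b s).
  apply: (@additive_eq0 G i _ iN) => [x y|u u0 ui].
    rewrite /G -big_split; apply: eq_bigr => t _ /=.
    by rewrite mulrDl tauD mulrDr.
  have u1 : u != 1 by apply: contraNneq ui => ->; rewrite expr1n.
  have E : G (u - 1)^-1 = u ^+ i * G (u - 1)^-1.
    rewrite /G mulr_sumr [LHS](reindex_inj (mulfI u0)) /=.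
    apply: eq_big => [t|t]; first by rewrite mulf_eq0 negb_or u0.
    rewrite mulf_eq0 negb_or u0 /= => t0.
    by rewrite exprMn -tbu // -mulrA.
  have /eqP : (1 - u ^+ i) * G (u - 1)^-1 = 0 by rewrite mulrBl mul1r -E subrr.
  by rewrite mulf_eq0 subr_eq0 eq_sym (negPf ui) => /eqP.
move=> x; have [->|x0'] := eqVneq x 0; first by rewrite subrr mulr0.
have := bc _ (invr_neq0 x0'); rewrite /b invrK invr1 mul1r => <-.
by rewrite mulrC mulVKf.
Qed.

(** The map [eps] factors through [P]: if [P x = P y], subtracting the slopes towards a third point
    [z] with [P x - P z = 1 / t] gives [tau (t * (eps x - eps y)) = 0]. *)
Lemma affine_of_slopes_along (X : choiceType) (P eps : X -> F) (a b : X) :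
  (forall y, exists x, P x = y) ->
  (forall x y, P x != P y -> tau ((eps x - eps y) / (P x - P y)) = 0) ->
  P a = 0 -> P b = 1 -> forall x, eps x - eps a = (eps b - eps a) * P x.
Proof.
move=> Psurj epsS Pa Pb.
have epsP x y : P x = P y -> eps x = eps y.
  move=> Pxy; apply/eqP; rewrite -subr_eq0; apply/eqP/tau_nondegenerate => t t0.
  have [z Pz] := Psurj (P x - t^-1).
  have tE : P x - P z = t^-1 by rewrite Pz subKr.
  have xz : P x != P z by rewrite -subr_eq0 tE invr_eq0.
  have -> : t * (eps x - eps y) = (eps x - eps z) / (P x - P z) - (eps y - eps z) / (P y - P z).
    by rewrite -Pxy tE invrK; ring.
  by rewrite (additiveB tauD) !epsS -?Pxy // subrr.
have Psurj' y : exists x, P x == y by have [x <-] := Psurj y; exists x.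
pose e w := eps (xchoose (Psurj' w)).
have eP x : e (P x) = eps x by apply: epsP; apply/eqP/(xchooseP (Psurj' (P x))).
move=> x; rewrite -!eP Pa Pb; apply: affine_of_slopes => y z.
have [y' <-] := Psurj y; have [z' <-] := Psurj z; rewrite !eP.
exact: epsS.
Qed.

End SlopesInKernel.

(** * Adjoints for the pairing [tau (x * y)] *)

Section Adjoint.
Variables (F : finFieldType) (tau : F -> F) (x0 : F).
Hypotheses (tauD : {morph tau : x y / x + y}) (tau_x0 : tau x0 != 0).

(** Nondegeneracy makes [h] bijective, and [g] is the adjoint of its inverse. *)
Lemma additive_of_adjoint (h g : F -> F) :
  (forall y t, tau (h y * g t) = tau (y * t)) -> {morph g : t u / t + u}.
Proof.
move=> hg t u.
have hinj : injective h.
  move=> y z hyz; apply/eqP; rewrite -subr_eq0; apply/eqP.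
  apply: (tau_nondegenerate tauD tau_x0) => s _.
  by rewrite mulrC mulrBl (additiveB tauD) -(hg y) -(hg z) hyz subrr.
apply/eqP; rewrite -subr_eq0; apply/eqP.
apply: (tau_nondegenerate tauD tau_x0) => s _.
have [h' _ h'K] := injF_bij hinj; rewrite -(h'K s) opprD addrA.
by rewrite 2!mulrBr 2!(additiveB tauD) !hg mulrDr tauD [tau _ + _]addrC addrK subrr.
Qed.

(* Writing [g x t = 1 / (f x - f (x - 1 / t))], each [g x] is additive, being an adjoint.
   As [f x = 1 / g 0 (1 / x)], this forces [g 1 t = 1 + f (t - 1)], so that [f] is additive. *)
Lemma hom_of_adjoint_slopes (f : F -> F) (h : F -> F -> F) : 2%:R != 0 :> F ->
  injective f -> f 0 = 0 -> f 1 = 1 ->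
  (forall x x' y, x != x' -> tau (h x y / (f x - f x')) = tau (y / (x - x'))) ->
  {morph f : x y / x + y} /\ {morph f : x y / x * y}.
Proof.
move=> two0 finj f0 f1 hf.
pose g x t := (f x - f (x - t^-1))^-1.
have gD x : {morph g x : t u / t + u}.
  apply: (@additive_of_adjoint (h x)) => y t.
  have [->|t0] := eqVneq t 0; first by rewrite /g invr0 subr0 subrr invr0 !mulr0.
  by rewrite /g hf ?subKr ?invrK // -subr_eq0 subKr invr_eq0.
pose k t := g 0 t.
have kN t : k (- t) = - k t by apply: (addrI (k t)); rewrite -[LHS](gD 0) !subrr /k (additive0 (gD 0)).
have fk s : f s = (k s^-1)^-1.
  have kE : k (- s^-1) = - (f s)^-1 by rewrite /k /g f0 invrN invrK !sub0r opprK invrN.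
  by rewrite -[k _]opprK -kN kE opprK invrK.
have k1 : k 1 = 1 by have := fk 1; rewrite invr1 f1 => /(congr1 GRing.inv); rewrite invrK invr1.
have kn0 t : t != 0 -> k t != 0.
  move=> t0; have E : f t^-1 = (k t)^-1 by rewrite fk invrK.
  by rewrite -invr_eq0 -E -[X in _ != X]f0 (inj_eq finj) invr_eq0.
have g1 t : g 1 t = 1 + f (t - 1).
  have [->|t0] := eqVneq t 0.
    by rewrite (additive0 (gD 1)) sub0r fk invrN invr1 kN k1 invrN invr1 subrr.
  have [->|t1] := eqVneq t 1; first by rewrite subrr /g invr1 subrr f0 f1 subr0 invr1 addr0.
  have t1' : t - 1 != 0 by rewrite subr_eq0.
  rewrite /g f1 !fk.
  (* Writing [c] for [k (1 / (t - 1))], additivity of [k] turns [g 1 t] into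
     [1 / (1 - 1 / (1 + c)) = 1 + 1 / c]. *)
  have -> : (1 - t^-1)^-1 = 1 + (t - 1)^-1 by field; rewrite t0 t1'.
  have := kn0 _ (invr_neq0 t1').
  rewrite /k (gD 0) -!/(k _) k1 => kt.
  have kt1 : 1 + k (t - 1)^-1 != 0.
    have -> : 1 + k (t - 1)^-1 = k (1 + (t - 1)^-1) by rewrite /k (gD 0) -!/(k _) k1.
    have -> : 1 + (t - 1)^-1 = t / (t - 1) by field.
    by rewrite kn0 // mulf_neq0 ?invr_neq0.
  by field; rewrite kt kt1.
have fD : {morph f : x y / x + y}.
  have fE x : f x = g 1 x.
    have g11 : g 1 1 = 1 by rewrite g1 subrr f0 addr0.
    by have := g1 (x + 1); rewrite addrK gD g11 addrC => /addrI.
  by move=> x y; rewrite !fE gD.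
split=> //; apply: (@hua_mul _ f k fD (gD 0) f1 two0) => x x0'.
by rewrite fk mulVf // kn0 // invr_neq0.
Qed.

End Adjoint.

(** * Galois rings *)

Section ResidueField.
Import ring_quotient.
Local Open Scope quotient_scope.
Variables (R : finComUnitRingType) (m : {pred R}).
Hypothesis unitE : forall x : R, (x \is a GRing.unit) = (x \notin m).
Hypotheses (m_ideal : idealr_closed m).

(** Any representative of a nonzero class lies outside [m], so it is a unit, and its inverse
    represents the inverse class. *)
Lemma exists_residue_field : exists (F : finFieldType) (pi : {rmorphism R -> F}),
  (forall x, (pi x == 0) = (x \in m)) /\ (forall y, exists x, pi x = y).
Proof.
pose m_zmod := GRing.isZmodClosed.Build R m (idealr_closedB m_ideal).
pose m_proper := isProperIdeal.Build R m (idealr_closed_nontrivial m_ideal).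
pose I : idealr R := HB.pack_for (idealr R) (m : R -> bool) m_zmod m_proper.
pose Q := {ideal_quot I}.
pose pi : {rmorphism R -> Q} := \pi_Q.
have pi0 x : (pi x == 0) = (x \in m).
  by rewrite -[0](rmorph0 pi) /pi /= -Quotient.idealrBE subr0.
have piK (y : Q) : pi (generic_quotient.repr y) = y by apply: reprK.
pose inv (y : Q) := if y == 0 then 0 else pi (generic_quotient.repr y)^-1.
have invV y : y != 0 -> inv y * y = 1.
  move=> y0; rewrite /inv (negPf y0) -[X in _ * X]piK -rmorphM mulVr ?rmorph1 //.
  by rewrite unitE -pi0 piK.
have inv0 : inv 0 = 0 by rewrite /inv eqxx.
pose fieldQ := GRing.ComNzRing_isField.Build Q invV inv0.
have enumQ : Finite.axiom (undup (map pi (enum R))).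
  move=> y; rewrite count_uniq_mem ?undup_uniq // mem_undup -[y]piK map_f //.
  by rewrite mem_enum.
pose finQ := isFinite.Build Q enumQ.
pose countQ := CanIsCountable (piK : cancel generic_quotient.repr pi).
pose F : finFieldType := HB.pack_for finFieldType Q fieldQ countQ finQ.
exists F, pi; split=> // y; exists (generic_quotient.repr (y : Q)); exact: piK.
Qed.

End ResidueField.

(** Being closed under addition, [A] is its own span over the prime field; [tau] is the identity
    minus a linear projection onto it. *)
Lemma exists_separating_additive (F : finFieldType) (A : {set F}) (z : F) :
  0 \in A -> {in A &, forall x y, x + y \in A} -> z \notin A ->
  exists tau : F -> F, [/\ {morph tau : x y / x + y}, tau z != 0 & {in A, forall x, tau x = 0}].
Proof.
move=> A0 AD zA; have [p pr_p chp] := finPcharP F.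
pose V : vectType 'F_p := pPrimeCharType chp.
pose X : seq V := enum A.
pose U := <<X>>%VS.
have UA (v : V) : v \in U -> v \in A.
  move=> vU; have := coord_span (X := in_tuple X) vU => ->.
  apply: (big_ind (fun v : F => v \in A)) => // i _.
  have xA : X`_i \in A by rewrite -mem_enum mem_nth.
  have xnA n : X`_i *+ n \in A.
    by elim: n => [|n IHn]; rewrite ?mulr0n // mulrSr AD.
  by rewrite /GRing.scale /= /pprimeChar_scale mulr_natl.
exists (fun v => (v : V) - projv U v); split.
- by move=> x y; rewrite (linearD (projv U)) opprD addrACA.
- apply: contra zA; rewrite subr_eq0 => /eqP E; apply: UA.
  by rewrite E memv_proj.
move=> x xA; rewrite projv_id ?subrr // memv_span //.
by rewrite mem_enum.
Qed.

Lemma val_unitP (R : finComUnitRingType) (k : {unit R}) : val k \is a GRing.unit.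
Proof. exact: (valP k). Qed.

(** * Scheme automorphisms and congruences modulo powers of [p] *)

Section LocalRing.
Variables (R : finComUnitRingType) (p d : nat).
Variables (F : finFieldType) (pi : {rmorphism R -> F}).
Hypotheses (pr_p : prime p) (p_gt2 : (2 < p)%N) (d_gt0 : (0 < d)%N).
Hypotheses (pd0 : (p ^ d)%:R = 0 :> R) (pd1 : (p ^ d.-1)%:R != 0 :> R).
Hypotheses (piU : forall x, (x \is a GRing.unit) = (pi x != 0)).
Hypotheses (pi_eq0 : forall x, pi x = 0 -> exists y, x = p%:R * y).
Hypotheses (pi_surj : forall y, exists x, pi x = y).
Variable K : {group {unit R}}.

Definition slopes_in (f : R -> R) : Prop :=
  forall x y, exists2 k, k \in K & f y - f x = (y - x) * val k.

Lemma cyc_autP (f : {perm R}) : reflect (slopes_in f) (f \in cyc_aut K).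
Proof.
rewrite inE; apply: (iffP forallP) => [h x y|h s].
  have /eqP E := h (y - x).
  have : (f x, f y) \in cyc_rel K (y - x).
    rewrite -E; apply/imsetP; exists (x, y) => //; rewrite inE /=.
    by apply/imsetP; exists 1%g; rewrite ?group1 // FinRing.val_unit1 mulr1.
  by rewrite inE /= => /imsetP[k kK ->]; exists k.
have finj : injective (fun u : R * R => (f u.1, f u.2)).
  by move=> [x y] [x' y'] [/perm_inj -> /perm_inj ->].
(* By finiteness, one inclusion suffices. *)
rewrite eqEcard card_imset // leqnn andbT.
apply/subsetP => u /imsetP[[x y]]; rewrite !inE /= => /imsetP[k kK xy] ->.
have [k' k'K E] := h x y; apply/imsetP; exists (k * k')%g; first exact: groupM.
by rewrite /= E xy mulrA.
Qed.

Lemma pi_p : pi p%:R = 0.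
Proof.
apply/eqP; have := congr1 pi pd0; rewrite rmorph0 natrX rmorphXn => /eqP.
by rewrite expf_eq0 => /andP[].
Qed.

Lemma pi_natX i : (0 < i)%N -> pi (p ^ i)%:R = 0.
Proof. by move=> i0; rewrite natrX rmorphXn pi_p expr0n eqn0Ngt i0. Qed.

(** Multiplying by [p ^ (d - 1 - i)] gives [p ^ (d - 1) x = 0], which is impossible for a unit
    [x]. *)
Lemma pX_dvd_pi i x y : (i < d)%N -> (p ^ i)%:R * x = (p ^ i.+1)%:R * y -> pi x = 0.
Proof.
move=> id /(congr1 (fun z => (p ^ (d.-1 - i))%:R * z)).
have d1 : (d.-1 - i + i = d.-1)%N by rewrite subnK // -ltnS prednK.
rewrite !mulrA -!natrM -!expnD addnS d1 prednK // pd0 mul0r => E.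
apply/eqP/contraT; rewrite -piU => xU; case/eqP: pd1.
by rewrite -[LHS](mulrK xU) E mul0r.
Qed.

Lemma pi_eq0_dvd i x : pi x = 0 -> exists y, (p ^ i)%:R * x = (p ^ i.+1)%:R * y.
Proof. by move=> /pi_eq0[y ->]; exists y; rewrite mulrA -natrM -expnSr. Qed.

(** With [a = p ^ i w = p b], the inner binomial terms beyond [p a] are divisible by [p a ^ 2], and
    [a ^ p] by [a ^ 3] as [p > 2]; all of them are multiples of [p a * p]. *)
Lemma exp_char_one_plus i w : (0 < i)%N ->
  exists2 w', pi w' = pi w & (1 + (p ^ i)%:R * w) ^+ p = 1 + (p ^ i.+1)%:R * w'.
Proof.
move=> i0; set a := (p ^ i)%:R * w.
have ap : exists b, a = p%:R * b.
  by exists ((p ^ i.-1)%:R * w); rewrite mulrA -natrM -expnS prednK.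
have [b ab] := ap.
have [P pE] : exists P, p = P.+3 by exists (p - 3)%N; rewrite -addn3 subnK.
pose S := \sum_(k < P.+1) a ^+ k *+ ('C(p, k.+2) %/ p)%N.
have E : (1 + a) ^+ p = 1 + p%:R * a * (1 + p%:R * (b * S + b ^+ 2 * a ^+ P)).
  have -> : (1 + a) ^+ p = 1 + p%:R * a + p%:R * a ^+ 2 * S + a ^+ 3 * a ^+ P.
    transitivity (\sum_(i < P.+4) a ^+ i *+ 'C(p, i)).
      rewrite exprDn -(big_mkord xpredT (fun i => a ^+ i *+ 'C(p, i))).
      rewrite -[P.+4]/(P.+3.+1) -pE big_mkord.
      by apply: eq_bigr => k _; rewrite expr1n mul1r.
    rewrite big_ord_recl big_ord_recl big_ord_recr /=.
    rewrite /bump /= !add1n expr0 bin0 bin1 expr1 mulr_natl -exprD -pE binn !mulr1n.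
    rewrite -!addrA; congr (1 + (_ + (_ + _))).
    rewrite mulr_sumr; apply: eq_bigr => k _.
    rewrite -mulrA mulrnAr -exprD mulr_natl -mulrnA divnK //.
      by rewrite prime_dvd_bin //= pE; apply: (ltn_ord k).
    by congr (_ ^+ _).
  have -> : a ^+ 3 = a * (p%:R * b) ^+ 2 by rewrite -ab -exprS.
  have -> : p%:R * a ^+ 2 * S = p%:R * a * (p%:R * b) * S by rewrite -ab expr2 mulrA.
  by move: (a ^+ P) => c; ring.
exists (w * (1 + p%:R * (b * S + b ^+ 2 * a ^+ P))).
  by rewrite rmorphM rmorphD rmorph1 rmorphM pi_p mul0r addr0 mulr1.
by rewrite E /a expnS natrM !mulrA.
Qed.

Lemma exp_one_plus i m w : (0 < i)%N ->
  exists2 w', pi w' = pi w & (1 + (p ^ i)%:R * w) ^+ (p ^ m) = 1 + (p ^ (i + m))%:R * w'.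
Proof.
move=> i0; elim: m => [|m [w' w'w IHm]]; first by exists w; rewrite // addn0.
have [|w'' w''w' E] := @exp_char_one_plus (i + m) w'; first by rewrite addn_gt0 i0.
by exists w''; rewrite ?w''w' // expnSr exprM IHm E addnS.
Qed.

Lemma slopes_inj f : slopes_in f -> injective f.
Proof.
move=> fS x y fxy; have [k _] := fS x y; rewrite fxy subrr => E.
by apply/esym/eqP; rewrite -subr_eq0 -[y - x](mulrK (val_unitP k)) -E mul0r.
Qed.

Lemma slopes_pi f : slopes_in f -> forall x y, (pi (f x) == pi (f y)) = (pi x == pi y).
Proof.
move=> fS x y; have [k _ E] := fS y x; rewrite -[LHS]subr_eq0 -[RHS]subr_eq0 -!rmorphB E rmorphM mulf_eq0.
by have := val_unitP k; rewrite piU => /negPf ->; rewrite orbF.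
Qed.

Lemma slopes_pi_surj f : slopes_in f -> forall y, exists x, pi (f x) = y.
Proof.
move=> /slopes_inj finj y; have [x <-] := pi_surj y.
by have [g _ gK] := injF_bij finj; exists (g x); rewrite gK.
Qed.

Definition hom_mod i (f : R -> R) : Prop :=
  (forall x y, exists e, f (x + y) - f x - f y = (p ^ i)%:R * e) /\
  (forall x y, exists e, f (x * y) - f x * f y = (p ^ i)%:R * e).

Lemma exists_residue_map f : slopes_in f ->
  exists2 phi : F -> F, injective phi & forall x, phi (pi x) = pi (f x).
Proof.
move=> fS; have /fin_all_exists[/= s sP] := pi_surj.
have phiE x : pi (f (s (pi x))) = pi (f x) by apply/eqP; rewrite slopes_pi // sP.
exists (fun w => pi (f (s w))) => // v w /eqP.
by rewrite slopes_pi // !sP => /eqP.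
Qed.

Lemma hom_mod1_of_residue_map f (phi : F -> F) : (forall x, phi (pi x) = pi (f x)) ->
  {morph phi : x y / x + y} -> {morph phi : x y / x * y} -> hom_mod 1 f.
Proof.
move=> phiE phiD phiM; split=> x y; apply: pi_eq0.
  by rewrite !rmorphB -!phiE rmorphD phiD addrAC addrK subrr.
by rewrite rmorphB rmorphM -!phiE rmorphM phiM subrr.
Qed.

Lemma two_neq0_residue : 2%:R != 0 :> F.
Proof.
have chp : p \in [pchar F] by rewrite inE pr_p -(rmorph_nat pi) pi_p eqxx.
by rewrite -(dvdn_pcharf chp) gtnNdvd.
Qed.

(** * Lifting the morphism property along powers of [p] *)

Section Functional.
Variables (tau : F -> F) (t0 : F).
Hypotheses (tauD : {morph tau : x y / x + y}) (tau_t0 : tau t0 != 0).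
Hypothesis tauK : forall w (u : {unit R}),
  u \in K -> val u = 1 + (p ^ d.-1)%:R * w -> tau (pi w) = 0.

(** Raising [k1 / k2] to the power [p ^ (d - 1 - i)] moves it to level [d - 1] and keeps the residue
    of [w]. *)
Lemma tau_unit_ratio i w k1 k2 : (0 < i < d)%N -> k1 \in K -> k2 \in K ->
  val k1 = val k2 * (1 + (p ^ i)%:R * w) -> tau (pi w) = 0.
Proof.
move=> /andP[i0 id] k1K k2K E; have [w' <- E'] := exp_one_plus (d.-1 - i) w i0.
apply: (@tauK w' ((k1 * k2^-1) ^+ (p ^ (d.-1 - i)))%g); first by rewrite groupX ?groupM ?groupV.
rewrite FinRing.val_unitX FinRing.val_unitM FinRing.val_unitV E mulrAC mulrV ?(val_unitP k2) // mul1r E'.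
by rewrite subnKC // -ltnS prednK.
Qed.

(** The slope of [g] divided by that of [f] is a quotient of two elements of [K] and equals
    [1 + p ^ i (E x - E y) / (f x - f y)]. *)
Lemma tau_slopes_diff f g i (E : R -> R) x y : slopes_in f -> slopes_in g -> (0 < i < d)%N ->
  (forall x, g x - f x = (p ^ i)%:R * E x) -> pi (f x) != pi (f y) ->
  tau ((pi (E x) - pi (E y)) / (pi (f x) - pi (f y))) = 0.
Proof.
move=> fS gS id gf fxy.
have DU : f x - f y \is a GRing.unit by rewrite piU rmorphB subr_eq0.
have xyU : x - y \is a GRing.unit by rewrite piU rmorphB subr_eq0 -(slopes_pi fS).
have [k2 k2K E2] := fS y x; have [k1 k1K E1] := gS y x.
have -> : (pi (E x) - pi (E y)) / (pi (f x) - pi (f y)) = pi ((E x - E y) / (f x - f y)).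
  by rewrite rmorphM rmorphV // !rmorphB.
apply: (tau_unit_ratio id k1K k2K); apply: (mulrI xyU).
rewrite -E1 mulrA -E2 mulrDr mulr1 mulrCA [(f x - f y) * _]mulrC divrK // mulrBr -!gf.
by ring.
Qed.

Lemma slopes_diff_affine f g i (E : R -> R) : slopes_in f -> slopes_in g -> (0 < i < d)%N ->
  f 0 = 0 -> f 1 = 1 -> (forall x, g x - f x = (p ^ i)%:R * E x) ->
  forall x, pi (E x) - pi (E 0) = (pi (E 1) - pi (E 0)) * pi (f x).
Proof.
move=> fS gS id f0 f1 gf.
apply: (affine_of_slopes_along tauD tau_t0 (P := pi \o f) (eps := pi \o E)) => /=.
- exact: slopes_pi_surj.
- by move=> x y; apply: tau_slopes_diff gf.
- by rewrite f0 rmorph0.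
- by rewrite f1 rmorph1.
Qed.

Lemma pi_of_pX_eq0 i x : (i < d)%N -> (p ^ i)%:R * x = 0 -> pi x = 0.
Proof. by move=> id E; apply: (@pX_dvd_pi i x 0 id); rewrite E mulr0. Qed.

(* The additive defect of [f] is, modulo [p], a multiple [a * f x * f z] of a symmetric bilinear
   form; its values at [x = 1] lie in the kernel of [tau], so that [a = 0]. *)
Lemma hom_mod_additive_step f i : slopes_in f -> f 0 = 0 -> f 1 = 1 -> (0 < i < d)%N ->
  (forall x y, exists e, f (x + y) - f x - f y = (p ^ i)%:R * e) ->
  forall x y, exists e, f (x + y) - f x - f y = (p ^ i.+1)%:R * e.
Proof.
move=> fS f0 f1 id fD; have [i0 i_lt] := andP id.
have /fin_all_exists[/= E EP] z := fin_all_exists (fun x => fD x z).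
pose g z x := f (x + z) - f z.
have gS z : slopes_in (g z).
  move=> x y; have [k kK Ek] := fS (x + z) (y + z); exists k => //.
  have -> : g z y - g z x = f (y + z) - f (x + z) by rewrite /g; ring.
  by rewrite Ek; congr (_ * _); ring.
have gE z x : g z x - f x = (p ^ i)%:R * E z x by rewrite -EP /g addrAC.
have E0 z : pi (E z 0) = 0.
  by apply: (pi_of_pX_eq0 i_lt); rewrite -EP add0r f0 subr0 subrr.
have EA z x : pi (E z x) = pi (E z 1) * pi (f x).
  by have := slopes_diff_affine fS (gS z) id f0 f1 (gE z) x; rewrite E0 !subr0.
have Esym z x : pi (E z x) = pi (E x z).
  apply/eqP; rewrite -subr_eq0 -rmorphB; apply/eqP/(pi_of_pX_eq0 i_lt).
  by rewrite mulrBr -!EP [x + z]addrC [_ - f x - f z]addrAC subrr.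
have E1 z : pi (E z 1) = pi (E 1 1) * pi (f z) by rewrite Esym EA.
have a0 : pi (E 1 1) = 0.
  apply: (tau_nondegenerate tauD tau_t0) => t _.
  have [z <-] := slopes_pi_surj fS t; rewrite mulrC -E1.
  have := @tau_slopes_diff _ _ _ _ 1 0 fS (gS z) id (gE z).
  by rewrite f1 f0 rmorph1 rmorph0 E0 !subr0 divr1; apply; rewrite oner_eq0.
move=> x z; rewrite EP; apply: pi_eq0_dvd.
by rewrite EA E1 a0 !mul0r.
Qed.

(** For a unit [z], the difference of [f] and [x |-> f (x z) / f z] vanishes at 0 and 1, so its
    affine leading term is zero. A nonunit [z] is reached from the unit [1 + z] by additivity. *)
Lemma hom_mod_step f i : slopes_in f -> f 0 = 0 -> f 1 = 1 -> (0 < i < d)%N ->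
  hom_mod i f -> hom_mod i.+1 f.
Proof.
move=> fS f0 f1 id [fD fM]; have [i0 i_lt] := andP id.
have fD' := hom_mod_additive_step fS f0 f1 id fD; split=> //.
have /fin_all_exists[/= E EP] z := fin_all_exists (fun x => fM x z).
have unit_case z x : z \is a GRing.unit -> exists e, f (x * z) - f x * f z = (p ^ i.+1)%:R * e.
  move=> zU; have [kz kzK Ez] := fS 0 z; rewrite f0 !subr0 in Ez.
  have fzU : f z \is a GRing.unit by rewrite Ez unitrM zU (val_unitP kz).
  pose g x := f (x * z) / f z.
  have gS : slopes_in g.
    move=> u v; have [k kK Ek] := fS (u * z) (v * z).
    exists (k * kz^-1)%g; first by rewrite groupM ?groupV.
    rewrite /g -mulrBl Ek Ez invrM ?(val_unitP kz) // FinRing.val_unitM FinRing.val_unitV.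
    rewrite -[RHS]mulr1 -(mulrV zU).
    by move: z^-1 (val kz)^-1 => a b; ring.
  have gE y : g y - f y = (p ^ i)%:R * (E z y / f z).
    by rewrite mulrA -EP mulrBl mulrK.
  have piE y : (pi (E z y / f z) == 0) = (pi (E z y) == 0).
    by rewrite rmorphM rmorphV // mulf_eq0 invr_eq0 -[pi (f z) == 0]negbK -piU fzU orbF.
  rewrite EP; apply/pi_eq0_dvd/eqP; rewrite -piE.
  have := slopes_diff_affine fS gS id f0 f1 gE x.
  have -> : pi (E z 0 / f z) = 0.
    apply/eqP; rewrite piE; apply/eqP/(pi_of_pX_eq0 i_lt).
    by rewrite -EP mul0r f0 mul0r subrr.
  have -> : pi (E z 1 / f z) = 0.
    apply/eqP; rewrite piE; apply/eqP/(pi_of_pX_eq0 i_lt).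
    by rewrite -EP mul1r f1 mul1r subrr.
  by rewrite !subr0 mul0r => ->.
move=> x z; have [zU|zU] := boolP (z \is a GRing.unit); first exact: unit_case.
have z1U : 1 + z \is a GRing.unit.
  by move: zU; rewrite !piU negbK rmorphD rmorph1 => /eqP ->; rewrite addr0 oner_eq0.
have [a Ea] := unit_case _ x z1U; have [b Eb] := fD' 1 z; have [c Ec] := fD' x (x * z).
exists (a + f x * b - c).
rewrite mulrBr mulrDr mulrCA -Ea -Eb -Ec f1 mulrDr mulr1.
by move: (f (x + x * z)) (f (1 + z)) (f (x * z)) (f x) (f z) => A B C D G; ring.
Qed.

(** Put [n = p ^ (d - 1)] and [f (x + n y) = f x + n H x y]. As [n ^ 2 = 0], the slopes from [x'] to
    [x + n y] and to [x] have ratio [1 + n (H x y / (f x - f x') - y / (x - x'))], so [tau] gives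
    the adjoint relation of [hom_of_adjoint_slopes]. *)
Lemma hom_mod_base f : (1 < d)%N -> slopes_in f -> f 0 = 0 -> f 1 = 1 -> hom_mod 1 f.
Proof.
move=> d1 fS f0 f1; set n : R := (p ^ d.-1)%:R.
have n0 : n * n = 0.
  rewrite -natrM -expnD; have -> : (d.-1 + d.-1 = d + d.-2)%N by lia.
  by rewrite expnD natrM pd0 mul0r.
have d1' : (0 < d.-1 < d)%N by rewrite -subn1 subn_gt0 d1 ltn_subrL d_gt0.
have pin : pi n = 0 by apply: pi_natX; case/andP: d1'.
have [phi phi_inj phiE] := exists_residue_map fS.
have /fin_all_exists[/= s sP] := pi_surj.
have fn x y : exists h, f (x + n * y) - f x = n * h.
  have [k _ ->] := fS x (x + n * y); exists (y * val k).
  by rewrite addrAC subrr add0r mulrA.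
have /fin_all_exists[/= H HP] x := fin_all_exists (fn x).
have [|||phiD phiM] :=
  hom_of_adjoint_slopes tauD tau_t0 (h := fun v w => pi (H (s v) (s w))) two_neq0_residue phi_inj.
- by rewrite -(rmorph0 pi) phiE f0.
- by rewrite -(rmorph1 pi) phiE f1.
- move=> v v' w vv'; set x := s v; set x' := s v'; set y := s w.
  have xx'U : x - x' \is a GRing.unit by rewrite piU rmorphB !sP subr_eq0.
  have DU : f x - f x' \is a GRing.unit.
    by rewrite piU rmorphB -!phiE !sP subr_eq0 (inj_eq phi_inj).
  have [k1 k1K E1] := fS x' (x + n * y); have [k2 k2K E2] := fS x' x.
  apply/eqP; rewrite -subr_eq0 -(additiveB tauD).
  have -> : pi (H x y) / (phi v - phi v') - w / (v - v') = pi (H x y / (f x - f x') - y / (x - x')).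
    by rewrite rmorphB !rmorphM !rmorphV // !rmorphB -!phiE !sP.
  apply/eqP/(tau_unit_ratio d1' k1K k2K); rewrite -/n.
  have zU : x + n * y - x' \is a GRing.unit.
    by rewrite piU addrAC rmorphD [pi (n * y)]rmorphM pin mul0r addr0 -piU.
  apply: (mulrI zU); rewrite -E1.
  have -> : f (x + n * y) - f x' = f x - f x' + n * H x y by rewrite -HP; ring.
  have -> : n * (H x y / (f x - f x') - y / (x - x')) = n * H x y / (f x - f x') - n * y / (x - x') by rewrite mulrBr !mulrA.
  apply: (mulIr xx'U); apply: (mulIr DU).
  move: (mulVr DU) (mulVr xx'U) => DV xV.
  rewrite [x + n * y - x']addrAC; move: DV xV E2 (H x y) => {HP E1 zU xx'U DU}.
  move: (f x - f x') (x - x') (f x - f x')^-1 (x - x')^-1 (val k2) => D e a b k Da eb De h.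
  (* This grouping isolates [n * n = 0] and the products [a * D] and [b * e], which equal 1. *)
  have -> : (e + n * y) * (k * (1 + (n * h * a - n * y * b))) * e * D
     = e * k * (e * D + n * h * e * (a * D) - n * y * (b * e) * D)
       + n * y * (e * k) * D + n * n * (y * k * (h * e * (a * D) - y * (b * e) * D)) by ring.
  by rewrite n0 Da eb -De; ring.
exact: (hom_mod1_of_residue_map phiE).
Qed.

Lemma hom_mod_all f : (1 < d)%N -> slopes_in f -> f 0 = 0 -> f 1 = 1 -> hom_mod d f.
Proof.
move=> d1 fS f0 f1; suff H i : (0 < i <= d)%N -> hom_mod i f by apply: H; rewrite d_gt0 /=.
elim: i => // -[_ _|i IHi /andP[_ id]]; first exact: hom_mod_base.
by apply: hom_mod_step => //; apply: IHi; apply: ltnW.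
Qed.

End Functional.

Lemma exists_tau_of_not_contained : (1 < d)%N -> ~ one_plus_contained K p d ->
  exists tau : F -> F, exists t0, [/\ {morph tau : x y / x + y}, tau t0 != 0 &
    forall w (u : {unit R}), u \in K -> val u = 1 + (p ^ d.-1)%:R * w -> tau (pi w) = 0].
Proof.
move=> d1 nK; set n : R := (p ^ d.-1)%:R.
have n0 : n * n = 0.
  rewrite -natrM -expnD; have -> : (d.-1 + d.-1 = d + d.-2)%N by lia.
  by rewrite expnD natrM pd0 mul0r.
pose A := [set pi w | w : R & [exists u : {unit R}, (u \in K) && (val u == 1 + n * w)]].
have [/existsP[u /existsP[w /andP[/eqP uE uK]]]|] :=
    boolP [exists u : {unit R}, exists w : R, (val u == 1 + n * w) && (u \notin K)]; last first.
  rewrite negb_exists => /forallP h; case: nK => u [w uE].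
  by have := h u; rewrite negb_exists => /forallP/(_ w); rewrite uE eqxx negbK.
(* Thus whether [1 + n w] lies in [K] depends only on the residue of [w]. *)
have nE x y : pi x = pi y -> n * x = n * y.
  move=> xy; have [z zE] : exists z, x - y = p%:R * z by apply: pi_eq0; rewrite rmorphB xy subrr.
  apply/eqP; rewrite -subr_eq0 -mulrBr zE mulrA -natrM -expnSr prednK // pd0.
  by rewrite mul0r.
have [|||tau [tauD tau0 tauA]] := @exists_separating_additive F A (pi w).
- apply/imsetP; exists 0; rewrite ?rmorph0 // inE; apply/existsP; exists 1%g.
  by rewrite group1 mulr0 addr0 /=.
- move=> _ _ /imsetP[x + ->] /imsetP[y + ->]; rewrite !inE.
  move=> /existsP[v /andP[vK /eqP vE]] /existsP[v' /andP[v'K /eqP v'E]].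
  apply/imsetP; exists (x + y); rewrite ?rmorphD // inE; apply/existsP; exists (v * v')%g.
  rewrite groupM // FinRing.val_unitM vE v'E; apply/eqP.
  have -> : (1 + n * x) * (1 + n * y) = 1 + n * (x + y) + n * n * (x * y) by ring.
  by rewrite n0 mul0r addr0.
- apply/negP => /imsetP[x]; rewrite inE => /existsP[v /andP[vK /eqP vE]] /nE wx.
  case/negP: uK; suff -> : u = v by [].
  by apply: val_inj; rewrite uE vE wx.
exists tau, (pi w); split=> // x v vK vE; apply: tauA.
apply/imsetP; exists x => //; rewrite inE; apply/existsP; exists v.
by rewrite vK vE eqxx.
Qed.

Lemma pi_inj_field : d = 1%N -> injective pi.
Proof.
move=> d1 x y xy; have [z zE] : exists z, x - y = p%:R * z.
  by apply: pi_eq0; rewrite rmorphB xy subrr.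
apply/eqP; rewrite -subr_eq0 zE; move: pd0; rewrite d1 expn1 => ->.
by rewrite mul0r.
Qed.

Lemma card_unit_field : d = 1%N -> #|F| = #|[set: {unit R}]|.+1.
Proof.
move=> d1; have pinj := pi_inj_field d1.
have <- : #|R| = #|F|.
  rewrite -(card_codom pinj); apply: eq_card => y.
  by have [x <-] := pi_surj y; rewrite codom_f.
rewrite cardsT card_sub (cardD1 0) /= add1n; congr _.+1.
apply: eq_card => x; rewrite !inE piU andbT -(rmorph0 pi).
by rewrite (inj_eq pinj).
Qed.

Lemma hom_mod_field f : d = 1%N -> K :!=: [set: {unit R}] ->
  slopes_in f -> f 0 = 0 -> f 1 = 1 -> hom_mod 1 f.
Proof.
move=> d1 KT fS f0 f1; have cardF := card_unit_field d1.
set N := #|_| in cardF.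
have chp : p \in [pchar F] by rewrite inE pr_p -(rmorph_nat pi) pi_p eqxx.
have [|||k [mk kN pk pk']] := @exists_exponent_coprime p N #|K| p_gt2.
- by rewrite -cardF (dvdn_pcharf chp) natr_card_finField.
- by rewrite cardSg ?subsetT.
- by rewrite cardG_gt0 proper_card // properEneq KT subsetT.
have fk x y : (f x - f y) ^+ k = (x - y) ^+ k.
  have [u uK ->] := fS y x; rewrite exprMn.
  have [c ->] := dvdnP mk; rewrite mulnC [val u ^+ _]exprM -FinRing.val_unitX.
  by rewrite expg_cardG // expr1n mulr1.
have [phi phi_inj phiE] := exists_residue_map fS.
have phi0 : phi 0 = 0 by rewrite -(rmorph0 pi) phiE f0.
have phi1 : phi 1 = 1 by rewrite -(rmorph1 pi) phiE f1.
have [|phiD phiM] := hom_of_powers cardF chp p_gt2 phi_inj phi0 phi1 kN pk pk'.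
  move=> v w; have [x <-] := pi_surj v; have [y <-] := pi_surj w.
  by rewrite !phiE -!rmorphB -!rmorphXn fk.
exact: (hom_mod1_of_residue_map phiE).
Qed.

(** Normalise by [f 0] and by the slope between 0 and 1, which lies in [K]; since [p ^ d = 0], the
    congruences become equalities. *)
Lemma in_AGammaL1_of_hom_mod f : slopes_in f ->
  (forall g, slopes_in g -> g 0 = 0 -> g 1 = 1 -> hom_mod d g) -> in_AGammaL1 f.
Proof.
move=> fS H; have [a aK] := fS 0 1; rewrite subr0 mul1r => fa.
pose g x := (f x - f 0) / val a.
have gS : slopes_in g.
  move=> x y; have [k kK E] := fS x y; exists (k * a^-1)%g; first by rewrite groupM ?groupV.
  rewrite /g -mulrBl FinRing.val_unitM FinRing.val_unitV mulrA -E; congr (_ / _).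
  by ring.
have g0 : g 0 = 0 by rewrite /g subrr mul0r.
have g1 : g 1 = 1 by rewrite /g fa divrr ?val_unitP.
have [gD gM] := H g gS g0 g1.
have gD' : {morph g : x y / x + y}.
  move=> x y; have [e] := gD x y; rewrite pd0 mul0r => /eqP.
  by rewrite -addrA -opprD subr_eq0 => /eqP.
have gM' : {morph g : x y / x * y}.
  by move=> x y; have [e] := gM x y; rewrite pd0 mul0r => /eqP; rewrite subr_eq0 => /eqP.
pose zg := GRing.isZmodMorphism.Build R R g (additiveB gD').
pose mg := GRing.isMonoidMorphism.Build R R g (g1, gM').
pose sigma : {rmorphism R -> R} := HB.pack_for {rmorphism R -> R} g zg mg.
exists a, (f 0), sigma; split; first exact/injF_bij/slopes_inj.
by move=> x; rewrite /= /g mulrC divrK ?val_unitP // subrK.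
Qed.

Lemma normal_of_not_contained : (1 < d)%N -> ~ one_plus_contained K p d -> cyc_normal K.
Proof.
move=> d1 nK f /cyc_autP fS.
have [tau [t0 [tauD tau0 tauK]]] := exists_tau_of_not_contained d1 nK.
by apply: in_AGammaL1_of_hom_mod => // g; apply: (hom_mod_all tauD tau0 tauK).
Qed.

Lemma normal_field : d = 1%N -> K :!=: [set: {unit R}] -> cyc_normal K.
Proof.
move=> d1 KT f /cyc_autP fS; apply: in_AGammaL1_of_hom_mod => // g.
by rewrite d1; apply: hom_mod_field.
Qed.

(** Adding [n = p ^ (d - 1)] on the maximal ideal only changes those differences that are units, and
    by a factor in [1 + n R], hence in [K]. *)
Lemma not_normal_of_contained : (1 < d)%N -> one_plus_contained K p d -> ~ cyc_normal K.
Proof.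
move=> d1 nK; set n : R := (p ^ d.-1)%:R.
have pin : pi n = 0 by apply: pi_natX; rewrite -subn1 subn_gt0.
pose f x := x + n *+ (pi x == 0).
have pif x : pi (f x) = pi x by rewrite rmorphD rmorphMn pin mul0rn addr0.
have finj : injective f.
  by move=> x y fxy; have := congr1 pi fxy; rewrite !pif => xy; move: fxy; rewrite /f xy => /addIr.
have fS : slopes_in f.
  move=> x y; have [xy|xy] := eqVneq (pi x) (pi y).
    by exists 1%g; rewrite ?group1 // FinRing.val_unit1 mulr1 /f xy opprD addrACA subrr addr0.
  have xyU : y - x \is a GRing.unit by rewrite piU rmorphB subr_eq0 eq_sym.
  pose c : R := (pi y == 0)%:R - (pi x == 0)%:R.
  have kU : 1 + n * (c / (y - x)) \is a GRing.unit.
    by rewrite piU rmorphD rmorph1 rmorphM pin mul0r addr0 oner_eq0.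
  exists (FinRing.unit R kU); first by apply: nK; exists (c / (y - x)).
  rewrite /= mulrDr mulr1 mulrCA [(y - x) * _]mulrC divrK // /f /c mulrBr !mulr_natr.
  by ring.
move=> /(_ (perm finj)) []; first by apply/cyc_autP => x y; rewrite !permE.
move=> a [b [sigma [_ sE]]].
(* The values [n], 1 and -1 at 0, 1 and -1 would force [2 n = 0]. *)
have s0 := sE 0; have s1 := sE 1; have sN1 := sE (-1); move: s0 s1 sN1.
rewrite !permE /f !rmorphN !rmorph1 !rmorph0 eqxx oppr_eq0 oner_eq0 /= !mulr0n !addr0 add0r mulr1n.
rewrite mulr0 add0r mulr1 mulrN1 => <- a1 aN1.
have n2 : n * 2%:R = 0.
  transitivity ((val a + n) + (- val a + n)); first by ring.
  by rewrite -[val a + n]a1 -[- val a + n]aN1 subrr.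
have U2 : 2%:R \is a @GRing.unit R by rewrite piU rmorph_nat two_neq0_residue.
by case/eqP: pd1; rewrite -/n -[LHS](mulrK U2) n2 mul0r.
Qed.

Lemma unit_field (x : R) : d = 1%N -> (x \is a GRing.unit) = (x != 0).
Proof. by move=> d1; rewrite piU -(rmorph0 pi) (inj_eq (pi_inj_field d1)). Qed.

(** Every permutation is an automorphism here. Transposing -1 with a fourth element fixes 0 and 1,
    whereas a semiaffine map fixing these also fixes -1. *)
Lemma not_normal_units_field : d = 1%N -> (3 < #|R|)%N -> K :=: [set: {unit R}] ->
  ~ cyc_normal K.
Proof.
move=> d1 cR KT; have RU x := unit_field x d1.
have N1_neq1 : -1 != 1 :> R.
  apply: contraNneq two_neq0_residue => E; rewrite -(rmorph_nat pi) mulr2n.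
  by rewrite -{1}E addNr rmorph0.
have [c /and3P[c0 c1 cN1]] : exists c : R, [&& c != 0, c != 1 & c != -1].
  apply/existsP; apply: contraLR cR; rewrite negb_exists -leqNgt => /forallP h.
  pose s : seq R := [:: 0; 1; -1]; apply: leq_trans (card_size s).
  rewrite -cardsT; apply/subset_leq_card/subsetP => x _; rewrite !inE.
  by have := h x; rewrite !negb_and !negbK.
pose f := tperm (-1) c.
have fS : slopes_in f.
  move=> x y; have [->|xy] := eqVneq x y.
    by exists 1%g; rewrite ?group1 // !subrr mul0r.
  have xyU : y - x \is a GRing.unit by rewrite RU subr_eq0 eq_sym.
  have kU : (f y - f x) / (y - x) \is a GRing.unit.
    by rewrite unitrM unitrV xyU andbT RU subr_eq0 (inj_eq perm_inj) eq_sym.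
  exists (FinRing.unit R kU); first by rewrite KT inE.
  by rewrite /= mulrC divrK.
move=> /(_ f) []; first exact/cyc_autP.
move=> a [b [sigma [_ sE]]].
have s0 := sE 0; have s1 := sE 1; have sN1 := sE (-1); move: s0 s1 sN1.
rewrite tpermL !tpermD ?oppr_eq0 ?oner_eq0 // rmorphN rmorph1 rmorph0.
rewrite mulr0 add0r mulr1 mulrN1 => <-; rewrite !addr0 => <- E.
by rewrite E eqxx in cN1.
Qed.

(** Every permutation of three elements is affine: its values sum to 0, so [f 0] and [f 1] determine
    [f (-1)]. *)
Lemma normal_card3 : d = 1%N -> p = 3%N -> #|R| = 3%N -> cyc_normal K.
Proof.
move=> d1 p3 cR f _; have RU x := unit_field x d1.
have three0 : 3%:R = 0 :> R by move: pd0; rewrite d1 p3.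
have N1_neq1 : -1 != 1 :> R.
  apply: contraNneq two_neq0_residue => E; rewrite -(rmorph_nat pi) mulr2n.
  by rewrite -{1}E addNr rmorph0.
have RE : [set: R] = [set 0; 1; -1].
  apply/esym/eqP; rewrite eqEcard subsetT cardsT cR -setUA cardsU1 cards2.
  by rewrite !inE eq_sym oner_eq0 eq_sym oppr_eq0 oner_eq0 eq_sym N1_neq1.
have sumE (g : R -> R) : \sum_x g x = g 0 + g 1 + g (-1).
  have -> : \sum_x g x = \sum_(x in [set 0; 1; -1]) g x.
    by rewrite -RE; apply: eq_bigl => x; rewrite inE.
  rewrite -setUA big_setU1 /=; last by rewrite !inE eq_sym oner_eq0 eq_sym oppr_eq0 oner_eq0.
  by rewrite big_setU1 ?big_set1 /= ?addrA // inE eq_sym.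
have fsum : f 0 + f 1 + f (-1) = 0.
  rewrite -sumE -[RHS](_ : \sum_x x = 0); last by rewrite (sumE id) add0r subrr.
  by rewrite [RHS](reindex_inj (@perm_inj _ f)).
have aU : f 1 - f 0 \is a GRing.unit.
  by rewrite RU subr_eq0 (inj_eq perm_inj) oner_eq0.
exists (FinRing.unit R aU), (f 0), idfun; split; first by exists id.
move=> x /=; have : x \in [set: R] by [].
rewrite RE !inE => /orP[/orP[]|] /eqP ->.
- by rewrite mulr0 add0r.
- by rewrite mulr1 subrK.
have -> : f (-1) = f 0 + f 1 + f (-1) - f 0 - f 1 by ring.
rewrite fsum; transitivity (0 - f 0 - f 1 + 3%:R * f 0); first by rewrite three0 mul0r addr0.
by ring.
Qed.

End LocalRing.

(** * Passage to the residue field and the case distinction *)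

Lemma idealmul_idealr (R : finComUnitRingType) (a : R) :
  a \isn't a GRing.unit -> idealr_closed (idealmul a : {pred R}).
Proof.
move=> aU; split=> [||c x y]; rewrite !inE.
- by apply/existsP; exists 0; rewrite mulr0.
- apply/existsP => -[y /eqP ya]; case/negP: aU.
  by apply/unitrP; exists y; rewrite mulrC -ya.
move=> /existsP[u /eqP ->] /existsP[v /eqP ->]; apply/existsP; exists (c * u + v).
by rewrite mulrDr mulrCA.
Qed.

Theorem theorem1p7 (p d r : nat) (R : finComUnitRingType)
  (HR : is_galois_ring R p d r) (Hp : (2 < p)%N) (K : {group {unit R}}) :
  cyc_normal K <->
  ((d = 1%N /\ ((p = 3%N /\ r = 1%N) \/ K :!=: [set: {unit R}]))
   \/ ((1 < d)%N /\ ~ one_plus_contained K p d)).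
Proof.
case: HR => -[pr_p d0 r0] [pd0 pd1] unitE cR.
have pU : (p%:R : R) \isn't a GRing.unit.
  by rewrite unitE negbK inE; apply/existsP; exists 1; rewrite mulr1.
have [F [pi [pi0 pi_surj]]] := exists_residue_field unitE (idealmul_idealr pU).
have piU x : (x \is a GRing.unit) = (pi x != 0) by rewrite unitE pi0.
have pi_eq0 x : pi x = 0 -> exists y, x = p%:R * y.
  by move=> /eqP; rewrite pi0 inE => /existsP[y /eqP]; exists y.
have cR1 : d = 1%N -> #|R| = (p ^ r)%N.
  move=> d1; rewrite -cardsT cR; move: pd0; rewrite d1 expn1 => ->.
  rewrite (_ : idealmul _ = [set 0]) ?cards1 ?muln1 //; apply/setP => x; rewrite !inE.
  apply/existsP/eqP => [[y /eqP ->]|->]; first by rewrite mul0r.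
  by exists 0; rewrite mul0r.
split=> [norm|[[d1 [[p3 r1]|KT]]|[d1 nK]]].
- have [d1|d1] := eqVneq d 1%N; last first.
    have d_gt1 : (1 < d)%N by rewrite ltn_neqAle eq_sym d1.
    right; split=> // nK.
    by apply: (not_normal_of_contained pr_p Hp pd0 pd1 piU d_gt1 nK).
  left; split=> //; have [KT|] := eqVneq (K : {set _}) [set: {unit R}]; last by right.
  (* With [p > 2], the bound [p ^ r <= 3] leaves only [p = 3] and [r = 1]. *)
  left; have [cR3|cR3] := leqP #|R| 3; last first.
    by case: (not_normal_units_field pr_p Hp pd0 piU pi_eq0 d1 cR3 KT norm).
  move: cR3; rewrite cR1 // => pr3.
  have p3 : p = 3%N.
    apply/eqP; rewrite eqn_leq Hp andbT; apply: leq_trans pr3.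
    by rewrite -{1}[p]expn1 leq_exp2l // prime_gt1.
  split=> //; apply/eqP; rewrite eqn_leq r0 andbT.
  by rewrite -(leq_exp2l _ _ (prime_gt1 pr_p)) {2}p3 expn1.
- apply: (@normal_card3 R p d F pi) => //.
  by rewrite cR1 // p3 r1.
- exact: (@normal_field R p d F pi).
exact: (@normal_of_not_contained R p d F pi).
Qed.
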